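(* Let $N$ be a Nijenhuis operator on an $n$-Lie algebra $(\mathfrak g,[\cdot,\dots,\cdot])$ over a field $\mathbb F$. Put $\omega_i(x_1,\dots,x_n)=[x_1,\dots,x_n]_N^{i}$ for $1\le i\le n-1$ and $x_1,\dots,x_n\in\mathfrak g$. Then $\omega_1,\dots,\omega_{n-1}$ generate an $(n-1)$-order $1$-parameter deformation of $(\mathfrak g,[\cdot,\dots,\cdot])$, and this deformation is trivial.
   Context: Let $n\ge 2$. An $n$-Lie algebra is a vector space $\mathfrak g$ with an $n$-multilinear skew-symmetric bracket $[\cdot,\dots,\cdot]:\wedge^n\mathfrak g\to\mathfrak g$ satisfying $[x_1,\dots,x_{n-1},[y_1,\dots,y_n]]=\sum_{i=1}^n[y_1,\dots,[x_1,\dots,x_{n-1},y_i],\dots,y_n]$ for all $x_i,y_i\in\mathfrak g$. For a linear map $N:\mathfrak g\to\mathfrak g$ define $n$-ary brackets $[\cdot,\dots,\cdot]_N^j$, $1\le j\le n-1$, by $[x_1,\dots,x_n]_N^1=\sum_{i=1}^n[x_1,\dots,Nx_i,\dots,x_n]-N[x_1,\dots,x_n]$ and, for $2\le j\le n-1$, $[x_1,\dots,x_n]_N^j=\sum_{i_1<\dots<i_j}[\dots,Nx_{i_1},\dots,Nx_{i_j},\dots]-N[x_1,\dots,x_n]_N^{j-1}$, where in the summand $N$ is applied exactly to the entries in positions $i_1,\dots,i_j$. The linear map $N$ is a Nijenhuis operator if $[Nx_1,\dots,Nx_n]=N([x_1,\dots,x_n]_N^{n-1})$ for all $x_1,\dots,x_n\in\mathfrak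 g$. Skew-symmetric $n$-multilinear maps $\omega_1,\dots,\omega_{n-1}$ from $\mathfrak g^n$ to $\mathfrak g$ generate an $(n-1)$-order $1$-parameter deformation if for every $\lambda\in\mathbb F$ the bracket $[x_1,\dots,x_n]_\lambda=[x_1,\dots,x_n]+\sum_{i=1}^{n-1}\lambda^i\omega_i(x_1,\dots,x_n)$ is an $n$-Lie algebra structure on $\mathfrak g$. Such a deformation is trivial if there is a linear map $N':\mathfrak g\to\mathfrak g$ such that for all $\lambda\in\mathbb F$ the map $T_\lambda=\mathrm{id}+\lambda N'$ satisfies $T_\lambda[x_1,\dots,x_n]_\lambda=[T_\lambda x_1,\dots,T_\lambda x_n]$ for all $x_1,\dots,x_n\in\mathfrak g$. *)

(* Defs.v *)
From HB Require Import structures.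
From mathcomp Require Import all_boot all_order all_fingroup all_algebra.

Set Implicit Arguments.
Unset Strict Implicit.
Unset Printing Implicit Defensive.

Import GRing.Theory.

Local Open Scope ring_scope.

(* An n-ary operation is a function of the finite family (x_1, ..., x_n),
   written x : {ffun 'I_n -> V}; the paper's position i is the ordinal i - 1. *)

Definition upd (n : nat) (T : Type) (x : {ffun 'I_n -> T}) (i : 'I_n) (v : T) :
    {ffun 'I_n -> T} :=
  [ffun k => if k == i then v else x k].

(* (x_1, ..., x_{n-1}, v): insub sends k < n - 1 to Some k, and n - 1 to None. *)
Definition snoc (n : nat) (T : Type) (x : {ffun 'I_n.-1 -> T}) (v : T) :
    {ffun 'I_n -> T} :=
  [ffun k : 'I_n => if insub (val k) is Some j then x j else v].

Definition apply_on (n : nat) (T : Type) (f : T -> T) (S : {set 'I_n})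
    (x : {ffun 'I_n -> T}) : {ffun 'I_n -> T} :=
  [ffun k => if k \in S then f (x k) else x k].

Section NLie.

Variables (F : fieldType) (V : lmodType F) (n : nat).
Implicit Types (br : {ffun 'I_n -> V} -> V) (x y : {ffun 'I_n -> V}).

Definition multilinear br : Prop :=
  forall x (i : 'I_n), linear (fun v : V => br (upd x i v)).

(* For multilinear br the two clauses together say that br factors through the
   n-th exterior power; the second one follows from the first unless F has
   characteristic 2. *)
Definition skew_symmetric br : Prop :=
  (forall x (s : 'S_n), br [ffun i => x (s i)] = (-1) ^+ s *: br x) /\
  (forall x (i j : 'I_n), i != j -> x i = x j -> br x = 0).

Definition fundamental_identity br : Prop :=
  forall (x : {ffun 'I_n.-1 -> V}) y,
    br (snoc x (br y)) = \sum_(i < n) br (upd y i (br (snoc x (y i)))).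

Definition n_Lie_bracket br : Prop :=
  [/\ multilinear br, skew_symmetric br & fundamental_identity br].

(* Setting [...]_N^0 := [...] makes the case j = 1 an instance of the recursion
   for j >= 2; see nijenhuis_bracket1. *)
Fixpoint nijenhuis_bracket br (N : V -> V) (j : nat) x : V :=
  if j is k.+1 then
    \sum_(S : {set 'I_n} | #|S| == j) br (apply_on N S x)
      - N (nijenhuis_bracket br N k x)
  else br x.

Lemma nijenhuis_bracket1 br (N : V -> V) x :
  nijenhuis_bracket br N 1 x =
  \sum_(i < n) br (upd x i (N (x i))) - N (br x).
Proof.
rewrite /=; congr (_ - _).
have im_set1 : [set S : {set 'I_n} | #|S| == 1%N] = [set [set i] | i : 'I_n].
  apply/setP=> S; rewrite inE; apply/cards1P/imsetP => [[i ->]|[i _ ->]];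
  by exists i.
rewrite (eq_bigl [in [set [set i] | i : 'I_n]]) => [|S]; last first.
  by rewrite -im_set1 inE.
rewrite big_imset /=; last by move=> i j _ _; apply: set1_inj.
apply: eq_bigr => i _; congr br; apply/ffunP=> k.
by rewrite !ffunE inE; case: eqP => // ->.
Qed.

Definition Nijenhuis_operator br (N : V -> V) : Prop :=
  forall x, br [ffun i => N (x i)] = N (nijenhuis_bracket br N n.-1 x).

Definition deformed_bracket br (omega : nat -> {ffun 'I_n -> V} -> V)
    (lambda : F) x : V :=
  br x + \sum_(1 <= i < n) lambda ^+ i *: omega i x.

(* Only omega 1, ..., omega (n - 1) are relevant. *)
Definition generates_deformation br (omega : nat -> {ffun 'I_n -> V} -> V) :
    Prop :=
  (forall i, (1 <= i < n)%N -> multilinear (omega i) /\ skew_symmetric (omega i))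
  /\ (forall lambda : F, n_Lie_bracket (deformed_bracket br omega lambda)).

Definition trivial_deformation br (omega : nat -> {ffun 'I_n -> V} -> V) :
    Prop :=
  exists N' : {linear V -> V}, forall lambda : F,
    let T := fun v : V => v + lambda *: N' v in
    forall x, T (deformed_bracket br omega lambda x) = br [ffun i => T (x i)].

End NLie.

(* Main.v *)
(** Let $\omega_0$ be the bracket and $\omega_i$ the $i$-th Nijenhuis bracket.
    The recursion for the $\omega_i$ says that
    $(1+\lambda N)\sum_{i<n}\lambda^i\omega_i(x)$ and $[(1+\lambda N)x]$ agree
    coefficient by coefficient in $\lambda$, the Nijenhuis condition being the
    coefficient of $\lambda^n$; this is triviality.  The fundamental
    identity of the original bracket then shows that $1+\lambda N$ kills the
    defect $\sum_k\lambda^k D_k$ of the fundamental identity of the deformed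
    bracket, again as a formal polynomial in $\lambda$.  Since $1+\lambda N$ is
    injective on formal polynomials, the defect vanishes.

    To stay inside $V$, the monomials $\lambda^k$ are replaced by arbitrary
    weights $w_k\in F$; then multiplication by $\lambda$ becomes the shift
    $w\mapsto w_{\cdot+1}$, and injectivity follows because shifting finitely
    supported weights eventually gives $0$. *)

From HB Require Import structures.
Require Import Defs.
From mathcomp Require Import all_boot all_order all_fingroup all_algebra.

Set Implicit Arguments.
Unset Strict Implicit.
Unset Printing Implicit Defensive.

Import GRing.Theory.

Local Open Scope ring_scope.

(** * Families with one entry or a set of entries changed *)

Lemma upd_at (n : nat) (T : Type) (x : {ffun 'I_n -> T}) i v : upd x i v i = v.
Proof. by rewrite ffunE eqxx. Qed.

Lemma upd_upd (n : nat) (T : Type) (x : {ffun 'I_n -> T}) i u v :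
  upd (upd x i u) i v = upd x i v.
Proof. by apply/ffunP=> k; rewrite !ffunE; case: eqP. Qed.

Lemma upd_id (n : nat) (T : Type) (x : {ffun 'I_n -> T}) i : upd x i (x i) = x.
Proof. by apply/ffunP=> k; rewrite ffunE; case: eqP => // ->. Qed.

Lemma apply_on_upd (n : nat) (T : Type) (f : T -> T) S (x : {ffun 'I_n -> T})
    i v :
  apply_on f S (upd x i v)
  = upd (apply_on f S x) i (if i \in S then f v else v).
Proof. by apply/ffunP=> k; rewrite !ffunE; case: eqP => // ->; case: ifP. Qed.

Lemma apply_on_setU1 (n : nat) (T : Type) (f : T -> T) S
    (x : {ffun 'I_n -> T}) i :
  apply_on f (i |: S) x = upd (apply_on f S x) i (f (x i)).
Proof.
by apply/ffunP=> k; rewrite !ffunE in_setU1; case: eqP => //= ->.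
Qed.

Lemma apply_on_notin (n : nat) (T : Type) (f : T -> T) (S : {set 'I_n})
    (x : {ffun 'I_n -> T}) i :
  i \notin S -> apply_on f S x i = x i.
Proof. by rewrite ffunE => /negPf ->. Qed.

Lemma apply_on_perm (n : nat) (T : Type) (f : T -> T) (S : {set 'I_n})
    (x : {ffun 'I_n -> T}) (s : 'S_n) :
  apply_on f S [ffun k => x (s k)] = [ffun k => apply_on f (s @: S) x (s k)].
Proof.
by apply/ffunP=> k; rewrite !ffunE mem_imset //; apply: perm_inj.
Qed.

Lemma snoc_upd (n : nat) (T : Type) (x : {ffun 'I_n.-1 -> T}) (l : 'I_n) u v :
  val l = n.-1 -> snoc x v = upd (snoc x u) l v.
Proof.
move=> lE; apply/ffunP=> k; rewrite !ffunE; case: insubP => [j _ jE|].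
  case: eqP => // kl; have := ltn_ord j.
  by rewrite -[nat_of_ord j]/(val j) jE kl lE ltnn.
rewrite -leqNgt => kn; case: eqP => // /eqP; rewrite -val_eqE lE eqn_leq kn.
by rewrite -ltnS prednK ?ltn_ord // (leq_ltn_trans _ (ltn_ord k)).
Qed.

(** Forgetting the last entry of [z] brings an update at the last slot into the [snoc] form used by
    the fundamental identity. *)
Lemma upd_last_snoc (n : nat) (T : Type) (z : {ffun 'I_n -> T}) (l : 'I_n) v :
  val l = n.-1 ->
  upd z l v = snoc [ffun k : 'I_n.-1 => z (widen_ord (leq_pred n) k)] v.
Proof.
move=> lE; rewrite (snoc_upd _ (z l) _ lE); congr (upd _ l v).
apply/ffunP=> k; rewrite !ffunE; case: insubP => [j _ jE|].
  by rewrite ffunE; congr (z _); apply: val_inj.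
rewrite -leqNgt => kn; congr (z _); apply: val_inj; apply/eqP.
rewrite lE eqn_leq kn andbT.
by rewrite -ltnS prednK ?ltn_ord // (leq_ltn_trans _ (ltn_ord k)).
Qed.

(** Adding [i] is a bijection from the sets avoiding [i] onto those containing it. *)
Lemma big_setU1_split (V : nmodType) (I : finType) (i : I) (f : {set I} -> V) :
  \sum_S f S = \sum_(S : {set I} | i \notin S) (f S + f (i |: S)).
Proof.
rewrite (bigID (fun S : {set I} => i \notin S)) big_split /=; congr (_ + _).
rewrite (reindex_onto (fun S : {set I} => i |: S) (fun S => S :\ i)) /=.
  apply: eq_bigl => S; rewrite in_setU1 eqxx /=.
  apply/eqP/idP => [<-|]; [by rewrite setD11 | exact: setU1K].
by move=> S; rewrite negbK => iS; apply: setD1K.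
Qed.

(** * Operations preserving skew-symmetric multilinear maps *)

Section Operations.

Variables (F : fieldType) (V : lmodType F) (n : nat).
Implicit Types (f : {ffun 'I_n -> V} -> V) (x y z : {ffun 'I_n -> V}).

Lemma linear_sumZ (I : Type) (r : seq I) (P : pred I) (U : lmodType F)
    (g : U -> V) (a : I -> F) (u : I -> U) : linear g ->
  g (\sum_(i <- r | P i) a i *: u i) = \sum_(i <- r | P i) a i *: g (u i).
Proof.
move=> g_lin; pose gL := GRing.isLinear.Build _ _ _ _ g g_lin.
pose h : {linear U -> V} := HB.pack g gL.
by rewrite -[g]/(h : U -> V) linear_sum; apply: eq_bigr => i _; rewrite linearZ.
Qed.

Lemma linearDg (U : lmodType F) (g : U -> V) u v : linear g ->
  g (u + v) = g u + g v.
Proof. by move=> g_lin; have := g_lin 1 u v; rewrite !scale1r. Qed.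

Definition skew_multilinear f := multilinear f /\ skew_symmetric f.

Lemma eq_skew_multilinear f g : f =1 g ->
  skew_multilinear f -> skew_multilinear g.
Proof.
move=> fg [mf [sf af]]; split; last split.
- by move=> x i a u v; rewrite -!fg; apply: mf.
- by move=> x s; rewrite -!fg.
- by move=> x i j ij xij; rewrite -fg; apply: af ij xij.
Qed.

Lemma skew_multilinear_sum (I : Type) (r : seq I) (P : pred I)
    (f : I -> {ffun 'I_n -> V} -> V) :
  (forall i, P i -> skew_multilinear (f i)) ->
  skew_multilinear (fun x => \sum_(i <- r | P i) f i x).
Proof.
move=> skf; split; last split.
- move=> x k a u v; rewrite scaler_sumr -big_split; apply: eq_bigr => i Pi.
  by case: (skf i Pi) => mf _; apply: mf.
- move=> x s; rewrite scaler_sumr; apply: eq_bigr => i Pi.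
  by case: (skf i Pi) => _ [-> _].
- move=> x k l kl xkl; apply: big1 => i Pi.
  by case: (skf i Pi) => _ [_ af]; apply: af kl xkl.
Qed.

Lemma skew_multilinear_comp f (g : {linear V -> V}) :
  skew_multilinear f -> skew_multilinear (fun x => g (f x)).
Proof.
move=> [mf [sf af]]; split; last split.
- by move=> x i a u v; rewrite mf linearP.
- by move=> x s; rewrite sf linearZ.
- by move=> x i j ij xij; rewrite (af _ _ _ ij xij) linear0.
Qed.

Lemma skew_multilinear_scale f a :
  skew_multilinear f -> skew_multilinear (fun x => a *: f x).
Proof. exact: (@skew_multilinear_comp f (GRing.scale a)). Qed.

Lemma skew_multilinear_sub f g :
  skew_multilinear f -> skew_multilinear g ->
  skew_multilinear (fun x => f x - g x).
Proof.
move=> [mf [sf af]] [mg [sg ag]]; split; last split.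
- by move=> x i a u v; rewrite mf mg scalerBr opprD addrACA.
- by move=> x s; rewrite sf sg scalerBr.
- by move=> x i j ij xij; rewrite (af _ _ _ ij xij) (ag _ _ _ ij xij) subrr.
Qed.

Lemma skew_multilinear_apply_on f (N : {linear V -> V}) m :
  skew_multilinear f ->
  skew_multilinear
    (fun x => \sum_(S : {set 'I_n} | #|S| == m) f (apply_on N S x)).
Proof.
move=> [mf [sf af]]; split; last split.
- move=> x i a u v; rewrite scaler_sumr -big_split; apply: eq_bigr => S _.
  by rewrite !apply_on_upd; case: ifP => _; rewrite ?linearP mf.
- move=> x s; rewrite scaler_sumr.
  rewrite [RHS](reindex_inj (imset_inj (@perm_inj _ s))) /=.
  apply: eq_big => S; first by rewrite card_imset //; apply: perm_inj.
  by rewrite apply_on_perm sf.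
- move=> x i j ij xij; pose s := tperm i j.
  have xs : [ffun k => x (s k)] = x.
    by apply/ffunP=> k; rewrite ffunE /s; case: tpermP => // ->.
  have sK : involutive (fun S : {set 'I_n} => s @: S).
    move=> S; rewrite -imset_comp -[RHS]imset_id; apply: eq_imset => k /=.
    by rewrite /s tpermK.
  have s_mem (S : {set 'I_n}) k : (k \in s @: S) = (s k \in S).
    by rewrite -[in RHS](sK S) [RHS]mem_imset //; apply: perm_inj.
  (* If [S] contains both or neither of [i] and [j], its term has two equal entries and vanishes.
     The transposition pairs the other sets with opposite signs, so no division by 2 occurs. *)
  rewrite (bigID (fun S : {set 'I_n} => (i \in S) == (j \in S))) /=.
  rewrite big1 ?add0r => [|S /andP[_ /eqP ijS]]; last first.
    by apply: (af _ i j ij); rewrite !ffunE ijS xij.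
  rewrite (bigID (fun S : {set 'I_n} => i \in S)) /= addrC.
  rewrite (reindex_inj (inv_inj sK)) /=.
  apply/eqP; rewrite addr_eq0 -sumrN; apply/eqP; apply: eq_big => S.
    rewrite !s_mem /s tpermL tpermR card_imset; last exact: perm_inj.
    by rewrite -!andbA; congr (_ && _); case: (i \in S); case: (j \in S).
  move=> _; rewrite -{1}xs apply_on_perm sK sf /s odd_tperm ij expr1.
  by rewrite scaleN1r.
Qed.

Lemma skew_multilinear_nijenhuis f (N : {linear V -> V}) m :
  skew_multilinear f -> skew_multilinear (nijenhuis_bracket f N m).
Proof.
move=> skf; elim: m => [|m IHm] //=.
apply: skew_multilinear_sub; first exact: skew_multilinear_apply_on.
exact: skew_multilinear_comp.
Qed.

End Operations.

(** Induction on the size of [A]: linearity in a slot [i] of [A] gives two terms, which collect the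
    subsets without [i] and those with [i]. *)
Lemma multilinear_apply_on (F : fieldType) (V : lmodType F) (n : nat)
    (f : {ffun 'I_n -> V} -> V) (N : V -> V) (a : F) (A : {set 'I_n})
    (x : {ffun 'I_n -> V}) : multilinear f ->
  f (apply_on (fun v => v + a *: N v) A x)
  = \sum_(S : {set 'I_n} | S \subset A) a ^+ #|S| *: f (apply_on N S x).
Proof.
move=> f_lin; have [m] := ubnP #|A|; elim: m A x => [|m IHm] // A x A_lt.
have [->|[i iA]] := set_0Vmem A.
  rewrite (big_pred1 set0) => [|S]; last by rewrite subset0.
  rewrite cards0 expr0 scale1r; congr f.
  by apply/ffunP=> k; rewrite !ffunE inE.
rewrite -(setD1K iA); move: A_lt; rewrite (cardsD1 i) iA => A_lt.
have {A_lt} IHA := IHm (A :\ i) _ A_lt; have {iA} := setD11 i A.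
move: {A}(A :\ i) IHA => A IHA /negbT iA.
rewrite apply_on_setU1 addrC f_lin.
rewrite -{2}(apply_on_notin (fun v => v + a *: N v) x iA).
rewrite upd_id IHA.
have -> : upd (apply_on (fun v => v + a *: N v) A x) i (N (x i))
    = apply_on (fun v => v + a *: N v) A (upd x i (N (x i))).
  by rewrite apply_on_upd (negPf iA).
rewrite IHA scaler_sumr addrC [RHS]big_mkcond (big_setU1_split i).
rewrite big_split /= -!big_mkcondr.
have sub_iA (S : {set 'I_n}) :
  i \notin S -> (S \subset i |: A) = (S \subset A).
  by move=> iS; rewrite -[in RHS](setU1K iA) subsetD1 iS andbT.
have notin_sub (S : {set 'I_n}) : S \subset A -> i \notin S.
  by move=> SA; apply: contra iA; apply: subsetP.
congr (_ + _); apply: eq_big => S.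
- apply/idP/andP=> [SA|[iS]]; last by rewrite sub_iA.
  by rewrite sub_iA ?notin_sub.
- by [].
- rewrite subUset sub1set setU11 /=.
  apply/idP/andP=> [SA|[iS]]; last by rewrite sub_iA.
  by rewrite sub_iA ?notin_sub.
- move=> SA; have iS := notin_sub S SA.
  by rewrite scalerA -exprS cardsU1 iS apply_on_setU1 apply_on_upd (negPf iS).
Qed.

(** * Brackets with weights in place of the powers of lambda *)

Section WeightedBrackets.

Variables (F : fieldType) (V : lmodType F) (n : nat).
Variables (br : {ffun 'I_n -> V} -> V) (N : {linear V -> V}).
Hypotheses (n_gt0 : (0 < n)%N) (br_Lie : n_Lie_bracket br).
Hypothesis N_Nij : Nijenhuis_operator br N.
Implicit Types (w : nat -> F) (x y z : {ffun 'I_n -> V}) (l : 'I_n).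

Local Notation omega := (nijenhuis_bracket br N).

Definition weighted_bracket w x : V := \sum_(i < n) w i *: omega i x.

Definition shift w : nat -> F := fun k => w k.+1.

Lemma br_skew_multilinear : skew_multilinear br.
Proof. by case: br_Lie. Qed.

Lemma weighted_bracket_skew_multilinear w :
  skew_multilinear (weighted_bracket w).
Proof.
apply: skew_multilinear_sum => i _; apply: skew_multilinear_scale.
exact/skew_multilinear_nijenhuis/br_skew_multilinear.
Qed.

(** The full set is the only one of size [n], so the vanishing of the recursion at [n] is exactly
    the Nijenhuis condition. *)
Lemma nijenhuis_bracket_top x : omega n x = 0.
Proof.
suff : omega n.-1.+1 x = 0 by rewrite prednK.
rewrite /= -N_Nij (big_pred1 [set: 'I_n]) => [|S]; last first.
  rewrite prednK //= eqEcard subsetT cardsT card_ord eqn_leq.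
  by rewrite -[X in (_ <= X)%N && _](card_ord n) max_card.
apply/eqP; rewrite subr_eq0; apply/eqP; congr br.
by apply/ffunP=> k; rewrite !ffunE inE.
Qed.

Lemma weighted_bracket_shift w x :
  weighted_bracket w x + N (weighted_bracket (shift w) x)
  = \sum_(S : {set 'I_n}) w #|S| *: br (apply_on N S x).
Proof.
pose B j := \sum_(S : {set 'I_n} | #|S| == j) br (apply_on N S x).
(* The recursion telescopes: the sum cut at [m] leaves the boundary term [w m *: omega m x], which
   vanishes at [m = n]. *)
have partial m : \sum_(i < m) w i *: omega i x
    + N (\sum_(i < m) w i.+1 *: omega i x) + w m *: omega m x
    = \sum_(j < m.+1) w j *: B j.
  elim: m => [|m IHm].
    rewrite !big_ord0 linear0 !add0r big_ord1 /B (big_pred1 set0) => [|S].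
      by congr (_ *: br _); apply/ffunP=> k; rewrite ffunE inE.
    by rewrite cards_eq0.
  rewrite [RHS]big_ord_recr -IHm /= !big_ord_recr /= linearD linearZ /=.
  rewrite scalerBr -/(B m.+1) [_ + (N _ + _)]addrACA.
  rewrite -[LHS]addrA -[RHS]addrA; congr (_ + _).
  by rewrite -addrA; congr (_ + _); rewrite addrC subrK.
have := partial n; rewrite nijenhuis_bracket_top scaler0 addr0 => ->.
(* Cardinals are at most [n], so [inord] never takes its default value. *)
pose size_class (S : {set 'I_n}) : 'I_n.+1 := inord #|S|.
rewrite [RHS](partition_big size_class predT) //=.
apply: eq_bigr => j _; rewrite scaler_sumr.
have SE (S : {set 'I_n}) : (size_class S == j) = (#|S| == j).
  rewrite -val_eqE /= inordK // ltnS.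
  by rewrite -[X in (_ <= X)%N]card_ord max_card.
by apply: eq_big => [S|S /eqP <-]; rewrite ?SE.
Qed.

(** The weight [w (i + j)] stands for a product of two powers of lambda; a general [w] does not
    factor, so this is not a composite of two weighted brackets. *)
Definition nested w z l y : V :=
  \sum_(j < n) weighted_bracket (fun i => w (i + j)%N) (upd z l (omega j y)).

(** A set containing [l] applies [N] to the inner bracket. Paired with the same set without [l], it
    gives [weighted_bracket_shift] for the inner bracket, with weights offset by [#|S|]. *)
Lemma nested_shift w z l y :
  nested w z l y + N (nested (shift w) z l y)
  = \sum_(S : {set 'I_n} | l \notin S) \sum_(S' : {set 'I_n})
      w (#|S| + #|S'|)%N *: br (upd (apply_on N S z) l (br (apply_on N S' y))).
Proof.
have [br_lin _] := br_skew_multilinear.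
rewrite /nested linear_sum -big_split /=.
under eq_bigr => j _ do rewrite weighted_bracket_shift.
rewrite exchange_big (big_setU1_split l); apply: eq_bigr => S lS.
have g_lin := br_lin (apply_on N S z) l.
rewrite -(linear_sumZ _ _ _ _ g_lin).
rewrite -(weighted_bracket_shift (fun k => w (#|S| + k)%N)).
rewrite (linearDg _ _ g_lin); congr (_ + _).
  rewrite (linear_sumZ _ _ _ _ g_lin).
  by apply: eq_bigr => j _; rewrite apply_on_upd (negPf lS).
rewrite linear_sum /=.
under [X in upd _ _ X]eq_bigr => j _ do rewrite linearZ /=.
rewrite (linear_sumZ _ _ _ _ g_lin); apply: eq_bigr => j _.
rewrite apply_on_setU1 apply_on_upd upd_upd upd_at cardsU1 lS.
by rewrite /shift addnS.
Qed.

Definition defect w z l y : V :=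
  nested w z l y - \sum_(k < n) nested w y k (upd z l (y k)).

Lemma fundamental_identity_upd z l y : val l = n.-1 ->
  br (upd z l (br y)) = \sum_(k < n) br (upd y k (br (upd z l (y k)))).
Proof.
move=> lE; have [_ _ br_fund] := br_Lie.
rewrite upd_last_snoc // br_fund; apply: eq_bigr => k _.
by rewrite (upd_last_snoc z (y k) lE).
Qed.

(** Everything expands into nested values of [br] with [N] on chosen entries; for each choice the
    original fundamental identity applies. *)
Lemma defect_shift w z l y : val l = n.-1 ->
  defect w z l y + N (defect (shift w) z l y) = 0.
Proof.
move=> lE; rewrite /defect linearB addrACA -opprD nested_shift linear_sum.
rewrite -big_split /=; under [X in _ - X]eq_bigr => k _ do rewrite nested_shift.
apply/eqP; rewrite subr_eq0; apply/eqP.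
under eq_bigr => S _.
  under eq_bigr => S' _.
    rewrite fundamental_identity_upd // scaler_sumr; over.
  rewrite exchange_big; over.
rewrite exchange_big; apply: eq_bigr => k _.
(* That [N] acts on [y k] is recorded on the left by [k] in the inner set, on the right by [l] in
   the inner set, since there [y k] occupies slot [l]. *)
under eq_bigr => S _ do rewrite (big_setU1_split k).
under [RHS]eq_bigr => S _ do rewrite (big_setU1_split l).
rewrite [RHS]exchange_big; apply: eq_bigr => S lS; apply: eq_bigr => S' kS'.
rewrite !apply_on_upd (negPf lS) !apply_on_setU1 !upd_upd upd_at setU11.
by rewrite apply_on_notin // !cardsU1 lS kS' !addnS addnC [(#|S'| + _)%N]addnC.
Qed.

(** Each shift lowers the bound [m] by one, until all weights are zero. *)
Lemma defect_eq0 m w z l y : val l = n.-1 ->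
  (forall k, (m <= k)%N -> w k = 0) -> defect w z l y = 0.
Proof.
move=> lE; elim: m w => [|m IHm] w w0.
  have nested0 z' l' y' : nested w z' l' y' = 0.
    by apply: big1 => j _; apply: big1 => i _; rewrite w0 ?scale0r.
  rewrite /defect nested0 big1 ?subr0 // => k _; apply: nested0.
have shift0 : defect (shift w) z l y = 0 by apply: IHm => k mk; apply: w0.
by have := defect_shift w z y lE; rewrite shift0 linear0 addr0.
Qed.

(** Power weights do factor, and both indices stay below [n], so only exponents below [n + n]
    occur. *)
Lemma nested_expr (lam : F) w z l y :
  (forall k, (k < n + n)%N -> w k = lam ^+ k) ->
  nested w z l y = weighted_bracket (fun k => lam ^+ k)
    (upd z l (weighted_bracket (fun k => lam ^+ k) y)).
Proof.
move=> wE.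
have [wb_lin _] := weighted_bracket_skew_multilinear (fun k => lam ^+ k).
rewrite [in RHS](linear_sumZ _ _ _ _ (wb_lin z l)).
apply: eq_bigr => j _; rewrite /weighted_bracket scaler_sumr.
apply: eq_bigr => i _; rewrite scalerA -exprD addnC wE //.
by rewrite -addSn leq_add // ltnW.
Qed.

Lemma weighted_bracket_fundamental (lam : F) :
  fundamental_identity (weighted_bracket (fun k => lam ^+ k)).
Proof.
(* Cutting the powers off at [n + n] makes the support finite without changing any weight used by
   [nested]. *)
move=> x y; pose w k := if (k < n + n)%N then lam ^+ k else 0.
have l_lt : (n.-1 < n)%N by rewrite prednK.
pose l := Ordinal l_lt; have lE : val l = n.-1 by [].
(* The entry 0 is a placeholder, overwritten by each update at [l]. *)
have snocE v : snoc x v = upd (snoc x 0) l v := snoc_upd x 0 v lE.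
have wE k : (k < n + n)%N -> w k = lam ^+ k by rewrite /w => ->.
have : defect w (snoc x 0) l y = 0.
  by apply: (@defect_eq0 (n + n)) => // k nk; rewrite /w ltnNge nk.
move/eqP; rewrite subr_eq0 (nested_expr _ _ _ wE) => /eqP defect0.
rewrite snocE defect0; apply: eq_bigr => k _.
by rewrite (nested_expr _ _ _ wE) [in RHS]snocE.
Qed.

Lemma deformed_bracketE (lam : F) :
  weighted_bracket (fun k => lam ^+ k) =1 deformed_bracket br omega lam.
Proof.
move=> x; rewrite /weighted_bracket /deformed_bracket.
rewrite -(big_mkord xpredT (fun i => lam ^+ i *: omega i x)) big_ltn //.
by rewrite expr0 scale1r.
Qed.

Lemma deformed_bracket_trivial (lam : F) x :
  deformed_bracket br omega lam x + lam *: N (deformed_bracket br omega lam x)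
  = br [ffun i => x i + lam *: N (x i)].
Proof.
have [br_lin _] := br_skew_multilinear.
rewrite -deformed_bracketE; set w := fun k => lam ^+ k.
have -> : [ffun i => x i + lam *: N (x i)]
    = apply_on (fun v => v + lam *: N v) setT x.
  by apply/ffunP=> i; rewrite !ffunE inE.
rewrite multilinear_apply_on //; under eq_bigl => S do rewrite subsetT.
(* For power weights, [shift w] is [lam] times [w]. *)
rewrite -(weighted_bracket_shift w) -linearZ; congr (_ + N _).
rewrite scaler_sumr; apply: eq_bigr => i _.
by rewrite scalerA -exprS.
Qed.

End WeightedBrackets.

Theorem theorem3p7 (F : fieldType) (V : lmodType F) (n : nat)
    (br : {ffun 'I_n -> V} -> V) (N : {linear V -> V})
    (n_ge2 : (2 <= n)%N) (br_Lie : n_Lie_bracket br)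
    (N_Nij : Nijenhuis_operator br N) :
  generates_deformation br (nijenhuis_bracket br N) /\
  trivial_deformation br (nijenhuis_bracket br N).
Proof.
have n_gt0 : (0 < n)%N := ltnW n_ge2.
have br_sm := br_skew_multilinear br_Lie.
split; [split|].
- by move=> i _; apply: skew_multilinear_nijenhuis.
- move=> lam; have wbE := deformed_bracketE br N n_gt0 lam.
  have [ml sk] := eq_skew_multilinear wbE
    (weighted_bracket_skew_multilinear N br_Lie _).
  split=> // x y.
  rewrite -!wbE weighted_bracket_fundamental //; apply: eq_bigr => k _.
  by rewrite -!wbE.
- by exists N => lam /= x; apply: deformed_bracket_trivial.
Qed.
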